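(* Let $C$ be the Cesàro operator and let $a=(a_n)_{n\geq1}$ be a nonnegative nonincreasing sequence of real numbers. Then $$\Vert Ca\Vert_{\mathrm{BMO}_{\mathrm d}}\geq \frac{\alpha_0}{8}\,\Vert a\Vert_{\mathrm{BMO}_{\mathrm d}}.$$
   Context: For a real sequence $a=(a_n)_{n\geq1}$, $(Ca)_n=\frac1n\sum_{k=1}^n a_k$, $n\geq1$. For a finite interval of consecutive integers $J=\{m,m+1,\ldots,n\}\subset\mathbb{N}=\{1,2,\dots\}$, set $a_J=\frac1{|J|}\sum_{k\in J}a_k$ and $\Omega_{\mathrm d}(a;J)=\frac1{|J|}\sum_{k\in J}|a_k-a_J|$, and let $\Vert a\Vert_{\mathrm{BMO}_{\mathrm d}}=\sup_{J\subset\mathbb{N}}\Omega_{\mathrm d}(a;J)$, the supremum being over all finite intervals of consecutive integers. The constant is $\alpha_0=\dfrac{4\log\gamma_1}{\gamma_1(1+\log\gamma_1)}\approx0.52123637$, where $\gamma_1>1$ is the (unique) solution in $(1,\infty)$ of $\log\!\left(\frac{\gamma}{1+\log\gamma}\right)=\frac{\log\gamma}{1+\log\gamma}$ ($\gamma_1\approx4.648717541$). *)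

(* Defs.v *)
From mathcomp Require Import all_boot all_order all_algebra.
From mathcomp Require Import all_classical all_reals all_analysis.
From mathcomp Require Import ring lra.

Set Implicit Arguments.
Unset Strict Implicit.
Unset Printing Implicit Defensive.

Import Order.TTheory GRing.Theory Num.Theory.
Import numFieldNormedType.Exports.

Local Open Scope classical_set_scope.
Local Open Scope ring_scope.

(* Sequences (a_n)_{n >= 1} are functions on [nat] whose value at 0 is never
   used: all the sums below start at an index >= 1 and the hypotheses on a
   sequence only concern indices >= 1. *)

Definition nonneg_seq (R : realType) (a : nat -> R) : Prop :=
  forall n : nat, (1 <= n)%N -> 0 <= a n.

Definition noninc_seq (R : realType) (a : nat -> R) : Prop :=
  forall m n : nat, (1 <= m)%N -> (m <= n)%N -> a n <= a m.

Definition cesaro_op (R : realType) (a : nat -> R) (n : nat) : R :=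
  (\sum_(1 <= k < n.+1) a k) / n%:R.

(* The interval J = {m, m + 1, ..., n}, with m <= n, has (n - m).+1 elements. *)
Definition seq_mean (R : realType) (a : nat -> R) (m n : nat) : R :=
  (\sum_(m <= k < n.+1) a k) / (n - m).+1%:R.

Definition seq_osc (R : realType) (a : nat -> R) (m n : nat) : R :=
  (\sum_(m <= k < n.+1) `|a k - seq_mean a m n|) / (n - m).+1%:R.

Definition bmo_norm (R : realType) (a : nat -> R) : \bar R :=
  ereal_sup [set x | exists m n : nat,
    [/\ (1 <= m)%N, (m <= n)%N & x = (seq_osc a m n)%:E]].

Definition gamma1_eq (R : realType) : set R :=
  [set g | 1 < g /\ ln (g / (1 + ln g)) = ln g / (1 + ln g)].

Definition gamma1 (R : realType) : R := get (@gamma1_eq R).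

Definition alpha0 (R : realType) : R :=
  4 * ln (gamma1 R) / (gamma1 R * (1 + ln (gamma1 R))).

(* With s = 1 + ln g, the equation for g reads ln s = (s - 1) ^ 2 / s. *)
Lemma gamma1_eqE (R : realType) (g : R) : 1 < g ->
  gamma1_eq g <-> ln (1 + ln g) = ln g ^+ 2 / (1 + ln g).
Proof.
move=> g1; have l0 : 0 < ln g by exact: ln_gt0.
have s0 : 0 < 1 + ln g by rewrite addr_gt0.
have E : ln g - ln g / (1 + ln g) = ln g ^+ 2 / (1 + ln g).
  by field; rewrite gt_eqF.
rewrite /gamma1_eq /= ln_div ?posrE//; last by rewrite (lt_trans _ g1).
split; first by case=> _; lra.
by move=> h; split => //; lra.
Qed.

Lemma ex_gamma1 (R : realType) : exists g : R, gamma1_eq g.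
Proof.
pose h (s : R) := s + s^-1 - 2 - ln s.
have ln2_ge : 2^-1 <= ln 2 :> R.
  rewrite -ler_expR lnK ?posrE// -[leRHS]invrK -[leLHS]invrK -expRN.
  rewrite lef_pV2 ?posrE ?expR_gt0 ?invr_gt0//.
  by apply: le_trans (expR_ge1Dx _); lra.
have ln2_le : ln 2 <= 1 :> R.
  by have := @le_ln1Dx R 1 ltac:(lra); rewrite -natr1.
have ln4 : ln 4 = 2 * ln 2 :> R.
  by rewrite (_ : 4 = 2 * 2) ?lnM ?posrE//; lra.
have ch : {within `[2, 4], continuous h}.
  apply: continuous_in_subspaceT => x; rewrite inE/= in_itv/= => /andP[x2 _].
  have x0 : 0 < x by lra.
  apply: cvgB; last exact: continuous_ln.
  apply: cvgB; last exact: cvg_cst.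
  by apply: cvgD; [exact: cvg_id | apply: cvgV; [rewrite gt_eqF|exact: cvg_id]].
have h2 : h 2 <= 0 by rewrite /h; lra.
have h4 : 0 <= h 4 by rewrite /h ln4; lra.
have [||s] := IVT (v := 0) _ ch; first by lra.
  by rewrite ge_min le_max h2 h4 orbT.
rewrite in_itv/= => /andP[s2 _] hs.
exists (expR (s - 1)); apply/gamma1_eqE; first by rewrite expR_gt1; lra.
rewrite expRK addrCA subrr addr0.
have -> : ln s = s + s^-1 - 2 by move: hs; rewrite /h; lra.
by field; rewrite gt_eqF//; lra.
Qed.

Lemma gamma1P (R : realType) : gamma1_eq (gamma1 R).
Proof. exact: getPex (ex_gamma1 R). Qed.

Lemma gamma1_uniq (R : realType) (g : R) : gamma1_eq g -> g = gamma1 R.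
Proof.
suff lt_absurd (x y : R) : gamma1_eq x -> gamma1_eq y -> ~ x < y.
  move=> hg; apply/le_anti; rewrite !leNgt.
  by apply/andP; split; apply/negP; apply: lt_absurd => //; exact: gamma1P.
move=> hx hy xy; have [[x1 _] [y1 _]] := (hx, hy).
move/(gamma1_eqE x1): hx; move/(gamma1_eqE y1): hy.
have : ln x < ln y by rewrite ltr_ln ?posrE//; lra.
have := ln_gt0 x1; move: (ln x) (ln y) => u v u0 uv Ev Eu.
have v0 : 0 < v by lra.
have le1 : - ln (1 + u) <= (1 + u)^-1 - 1.
  rewrite -lnV ?posrE; last lra.
  have := @le_ln1Dx R ((1 + u)^-1 - 1); rewrite addrCA subrr addr0; apply.
  have : 0 < (1 + u)^-1 by rewrite invr_gt0; lra.
  lra.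
have le2 : ln (1 + v) - ln (1 + u) <= (1 + v) / (1 + u) - 1.
  rewrite -ln_div ?posrE; [|lra|lra].
  have := @le_ln1Dx R ((1 + v) / (1 + u) - 1); rewrite addrCA subrr addr0; apply.
  have : 0 < (1 + v) / (1 + u) by rewrite divr_gt0//; lra.
  lra.
have : (v - u) * - ln (1 + u) + u * (ln (1 + v) - ln (1 + u)) <=
       (v - u) * ((1 + u)^-1 - 1) + u * ((1 + v) / (1 + u) - 1).
  by apply: lerD; apply: ler_wpM2l => //; lra.
have -> : (v - u) * ((1 + u)^-1 - 1) + u * ((1 + v) / (1 + u) - 1) = 0.
  by field; rewrite gt_eqF//; lra.
rewrite Ev Eu.
have -> : (v - u) * - (u ^+ 2 / (1 + u)) +
          u * (v ^+ 2 / (1 + v) - u ^+ 2 / (1 + u)) =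
          u * v * (v - u) / ((1 + u) * (1 + v)).
  by field; rewrite !gt_eqF//; lra.
apply/negP; rewrite -ltNge divr_gt0// !mulr_gt0//; lra.
Qed.

(* Main.v *)
Require Import Defs.
From mathcomp Require Import all_boot all_order all_algebra.
From mathcomp Require Import all_classical all_reals all_analysis.
From mathcomp Require Import ring lra zify.

Import Order.TTheory GRing.Theory Num.Theory.

Local Open Scope ring_scope.

(** Write [A = Ca], [M] for the norm of [A], and [D = A - a].  Since [a] is
    nonincreasing, [D >= 0], and the mean of [a] over [{n+1, ..., 2n}] is at
    most [a_n], so that [A_n - A_(2n) >= D_n / 2].  On the other hand [A] is
    nonincreasing too, and comparing its values on the three thirds of
    [{1, ..., 3n}] bounds the drop [A_n - A_(2n)] by [9/2 M].  Hence
    [0 <= D <= 9 M] ([cesaro_gap_le]).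

    A sequence with values in [[0, S]] has oscillations at most [S / 2], and
    oscillations are subadditive, so [a = A - D] has norm at most
    [M + 9/2 M = 11/2 M].  Finally [alpha0 <= 1], because [gamma1 >= 1 + L]
    with [L = ln gamma1] and [4 L <= (1 + L) ^ 2]; so the constant
    [alpha0 / 8] is below [2 / 11]. *)

(** * Sums and oscillations over an interval of integers *)

Lemma sum_nat_ge (R : realType) (f : nat -> R) (c : R) (m n : nat) :
  (forall k, (m <= k < n)%N -> c <= f k) ->
  (n - m)%:R * c <= \sum_(m <= k < n) f k.
Proof.
move=> fc; rewrite mulr_natl -sumr_const_nat.
by apply: ler_sum_nat => k /fc.
Qed.

Lemma sum_nat_le (R : realType) (f : nat -> R) (c : R) (m n : nat) :
  (forall k, (m <= k < n)%N -> f k <= c) ->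
  \sum_(m <= k < n) f k <= (n - m)%:R * c.
Proof.
move=> fc; rewrite mulr_natl -sumr_const_nat.
by apply: ler_sum_nat => k /fc.
Qed.

Lemma sum_seq_mean (R : realType) (f : nat -> R) (m n : nat) :
  \sum_(m <= k < n.+1) f k = (n - m).+1%:R * seq_mean f m n.
Proof. by rewrite /seq_mean mulrC divfK// pnatr_eq0. Qed.

Lemma seq_osc_ge0 (R : realType) (f : nat -> R) (m n : nat) :
  0 <= seq_osc f m n.
Proof. by rewrite divr_ge0// sumr_ge0. Qed.

Lemma seq_oscB (R : realType) (f g : nat -> R) (m n : nat) :
  seq_osc (fun k => f k - g k) m n <= seq_osc f m n + seq_osc g m n.
Proof.
rewrite /seq_osc -mulrDl ler_wpM2r ?invr_ge0// -big_split/=.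
apply: ler_sum => k _.
have -> : seq_mean (fun k => f k - g k) m n = seq_mean f m n - seq_mean g m n.
  by rewrite /seq_mean sumrB mulrBl.
have -> : f k - g k - (seq_mean f m n - seq_mean g m n) =
          (f k - seq_mean f m n) - (g k - seq_mean g m n) by ring.
exact: ler_normB.
Qed.

(** Since the deviations from the mean sum to zero, each side of a cut of the
    interval carries at least the absolute value of the same partial sum. *)
Lemma seq_osc_ge_cut (R : realType) (f : nat -> R) (m p n : nat) :
  (m <= p <= n.+1)%N ->
  2 * \sum_(m <= k < p) (f k - seq_mean f m n) <=
  (n - m).+1%:R * seq_osc f m n.
Proof.
move=> /andP[mp pn]; rewrite /seq_osc [leRHS]mulrC divfK ?pnatr_eq0//.
have [mn|nm] := leqP m n; last first.
  have -> : m = n.+1 by lia.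
  have -> : p = n.+1 by lia.
  by rewrite !big_geq// mul0r.
have sum0 : \sum_(m <= k < n.+1) (f k - seq_mean f m n) = 0.
  rewrite sumrB sum_seq_mean sumr_const_nat subSn//.
  by rewrite mulr_natl subrr.
rewrite (big_cat_nat mp pn)/= in sum0.
rewrite (big_cat_nat mp pn)/=.
set P := \sum_(m <= k < p) _ in sum0 *.
have H1 : P <= \sum_(m <= k < p) `|f k - seq_mean f m n|.
  by apply: ler_sum => k _; exact: ler_norm.
have H2 : - (\sum_(p <= k < n.+1) (f k - seq_mean f m n)) <=
          \sum_(p <= k < n.+1) `|f k - seq_mean f m n|.
  by rewrite -sumrN; apply: ler_sum => k _; rewrite -normrN ler_norm.
lra.
Qed.

(** By convexity, the graph of [|x - mu|] over [[0, S]] lies below its chord;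
    averaging the chord gives [2 mu (S - mu) / S], which is at most [S / 2]. *)
Lemma seq_osc_le_half (R : realType) (f : nat -> R) (S : R) (m n : nat) :
  (m <= n)%N -> (forall k, (m <= k <= n)%N -> 0 <= f k <= S) ->
  seq_osc f m n <= S / 2.
Proof.
move=> mn f0S; set mu := seq_mean f m n.
have N0 : 0 < (n - m).+1%:R :> R by rewrite ltr0n.
have mu0 : 0 <= mu.
  rewrite /mu /seq_mean divr_ge0// big_nat sumr_ge0// => k.
  by rewrite ltnS => /f0S /andP[].
have muS : mu <= S.
  rewrite /mu /seq_mean ler_pdivrMr// mulrC -subSn//.
  by apply: sum_nat_le => k; rewrite ltnS => /f0S /andP[].
have [S0|S0] := leP S 0.
  rewrite /seq_osc big_nat big1 ?mul0r; first lra.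
  move=> k; rewrite ltnS => /f0S /andP[h1 h2]; apply/eqP; rewrite normr_eq0.
  by rewrite -/mu; apply/eqP; lra.
have chord k : (m <= k < n.+1)%N ->
    `|f k - mu| <= (f k * (S - mu) + mu * (S - f k)) / S.
  rewrite ltnS => /f0S /andP[h1 h2]; rewrite ler_pdivlMr//.
  by case: (lerP mu (f k)) => ?; nra.
rewrite /seq_osc ler_pdivrMr// -/mu.
apply: le_trans (ler_sum_nat chord) _.
have -> : \sum_(m <= k < n.+1) ((f k * (S - mu) + mu * (S - f k)) / S) =
    (n - m).+1%:R * (2 * mu * (S - mu) / S).
  rewrite -mulr_suml big_split/= -mulr_suml -mulr_sumr sumrB sum_seq_mean.
  rewrite -/mu sumr_const_nat -[S *+ _]mulr_natl subSn//.
  by field; rewrite gt_eqF.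
rewrite mulrC ler_pM2r// ler_pdivrMr//.
have := sqr_ge0 (S - 2 * mu); nra.
Qed.

(** * Averages of a nonincreasing sequence *)

Section Cesaro.
Variables (R : realType) (a : nat -> R).
Hypothesis a_noninc : noninc_seq a.

Let A := cesaro_op a.

Lemma sum_cesaro (n : nat) : (1 <= n)%N ->
  \sum_(1 <= k < n.+1) a k = n%:R * A n.
Proof. by move=> n1; rewrite /A /cesaro_op mulrC divfK// pnatr_eq0 -lt0n. Qed.

Lemma cesaro_ge (n : nat) : (1 <= n)%N -> a n <= A n.
Proof.
move=> n1; rewrite /A /cesaro_op ler_pdivlMr ?ltr0n// mulrC.
have := @sum_nat_ge R a (a n) 1 n.+1; rewrite subSS subn0; apply => k.
by rewrite ltnS => /andP[k1 kn]; exact: a_noninc.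
Qed.

(** Every term added to the sum between [m] and [n] is at most [a_m].  Since
    [a_m <= A_m], this makes [A] nonincreasing; keeping [a_m] in the bound gives
    the estimate of [A_n - a_n] by a drop of [A]. *)
Lemma cesaro_sum_le (m n : nat) : (1 <= m)%N -> (m <= n)%N ->
  n%:R * A n <= m%:R * A m + (n - m)%:R * a m.
Proof.
move=> m1 mn; rewrite -!sum_cesaro//; last exact: leq_trans mn.
rewrite (@big_cat_nat _ _ _ m.+1)//= lerD2l -subSS.
apply: sum_nat_le => k /andP[mk _]; exact: a_noninc (ltnW mk).
Qed.

Lemma cesaro_noninc : noninc_seq A.
Proof.
move=> m n m1 mn; have n1 := leq_trans m1 mn.
have := cesaro_sum_le _ _ m1 mn; rewrite natrB// => h.
have mnR : m%:R <= n%:R :> R by rewrite ler_nat.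
have n0 : 0 < n%:R :> R by rewrite ltr0n.
have := cesaro_ge _ m1 => h2.
rewrite -(ler_pM2l n0); nra.
Qed.

Lemma cesaro_gap_le_drop (n : nat) : (1 <= n)%N ->
  A n - a n <= 2 * (A n - A (2 * n)%N).
Proof.
move=> n1; have := cesaro_sum_le n (2 * n)%N n1 ltac:(lia).
have -> : (2 * n - n = n)%N by lia.
rewrite natrM -mulrDr [2 * _]mulrC -mulrA ler_pM2l ?ltr0n//; lra.
Qed.

(** On [{1, ..., 3n}] the first third of [A] lies above [A_n], the second one
    below [A_n], and the third one below [A_(2n)]. *)
Lemma cesaro_drop_le (n : nat) : (1 <= n)%N ->
  A n - A (2 * n)%N <= 9 / 2 * seq_osc A 1 (3 * n).
Proof.
move=> n1; have := @seq_osc_ge_cut R A 1 n.+1 (3 * n) ltac:(lia).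
have := sum_seq_mean _ A 1 (3 * n).
set mu := seq_mean _ _ _; set w := seq_osc _ _ _.
have -> : ((3 * n - 1).+1 = 3 * n)%N by lia.
rewrite (@big_cat_nat _ _ _ n.+1)//=; last by lia.
rewrite (@big_cat_nat _ _ _ (2 * n).+1 n.+1)//=; [|lia|lia].
rewrite sumrB sumr_const_nat -[mu *+ _]mulr_natl subSS subn0.
have := @sum_nat_ge R A (A n) 1 n.+1.
have := @sum_nat_le R A (A n) n.+1 (2 * n).+1.
have := @sum_nat_le R A (A (2 * n)%N) (2 * n).+1 (3 * n).+1.
rewrite !subSS subn0 (_ : (3 * n - 2 * n = n)%N); last by lia.
rewrite (_ : (2 * n - n = n)%N); last by lia.
move=> /(_ _)h3 /(_ _)h2 /(_ _)h1; rewrite natrM => hs hc.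
have {}h1 : n%:R * A n <= \sum_(1 <= k < n.+1) A k.
  by apply: h1 => k /andP[k1 kn]; exact: cesaro_noninc.
have {}h2 : \sum_(n.+1 <= k < (2 * n).+1) A k <= n%:R * A n.
  by apply: h2 => k /andP[k1 kn]; apply: cesaro_noninc => //; exact: ltnW.
have {}h3 : \sum_((2 * n).+1 <= k < (3 * n).+1) A k <= n%:R * A (2 * n)%N.
  by apply: h3 => k /andP[k1 kn]; apply: cesaro_noninc; lia.
have n0 : 0 < n%:R :> R by rewrite ltr0n.
rewrite -(ler_pM2l n0); lra.
Qed.

Lemma cesaro_gap_le (M : R) (n : nat) : (1 <= n)%N ->
  (forall p q : nat, (1 <= p)%N -> (p <= q)%N -> seq_osc A p q <= M) ->
  0 <= A n - a n <= 9 * M.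
Proof.
move=> n1 oscM; rewrite subr_ge0 cesaro_ge//=.
have := cesaro_gap_le_drop n n1; have := cesaro_drop_le n n1.
have := oscM 1%N (3 * n)%N isT ltac:(lia); lra.
Qed.

Lemma seq_osc_le_cesaro (M : R) (m n : nat) : (1 <= m)%N -> (m <= n)%N ->
  (forall p q : nat, (1 <= p)%N -> (p <= q)%N -> seq_osc A p q <= M) ->
  seq_osc a m n <= 11 / 2 * M.
Proof.
move=> m1 mn oscM.
have -> : a = (fun k => A k - (A k - a k)).
  by apply/funext => k; rewrite opprB addrC subrK.
apply: le_trans (seq_oscB _ _ _ _ _) _.
have := @seq_osc_le_half R (fun k => A k - a k) (9 * M) m n mn.
have := oscM m n m1 mn => h1 /(_ _) h2.
have {}h2 : seq_osc (fun k => A k - a k) m n <= 9 * M / 2.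
  by apply: h2 => k /andP[mk _]; apply: cesaro_gap_le => //; exact: leq_trans mk.
lra.
Qed.

End Cesaro.

(** * The constant *)

Lemma alpha0_bounds (R : realType) : 0 <= alpha0 R <= 1.
Proof.
have [g1 _] := gamma1P R; rewrite /alpha0; set g := gamma1 R in g1 *.
have L0 : 0 < ln g by exact: ln_gt0.
have gL : 1 + ln g <= g.
  have := @le_ln1Dx R (g - 1); rewrite addrCA subrr addr0.
  by move=> /(_ ltac:(lra)); lra.
have d0 : 0 < g * (1 + ln g) by rewrite mulr_gt0//; lra.
rewrite divr_ge0 ?(ltW d0)//=; last by rewrite mulr_ge0// ltW.
rewrite ler_pdivrMr// mul1r.
have := sqr_ge0 (1 - ln g); nra.
Qed.

Theorem proposition5p1 (R : realType) (a : nat -> R)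
    (a_ge0 : nonneg_seq a) (a_noninc : noninc_seq a) :
  ((alpha0 R / 8)%:E * bmo_norm a <= bmo_norm (cesaro_op a))%E.
Proof.
have osc_le_norm p q : (1 <= p)%N -> (p <= q)%N ->
    ((seq_osc (cesaro_op a) p q)%:E <= bmo_norm (cesaro_op a))%E.
  by move=> p1 pq; apply: ereal_sup_ubound; exists p, q.
have /andP[al0 al1] := alpha0_bounds R.
case E : (bmo_norm (cesaro_op a)) => [M| |]; first last.
- by have := osc_le_norm 1%N 1%N isT isT; rewrite E.
- exact: leey.
have oscM p q : (1 <= p)%N -> (p <= q)%N -> seq_osc (cesaro_op a) p q <= M.
  by move=> p1 pq; rewrite -lee_fin -E; exact: osc_le_norm.
have M0 : 0 <= M := le_trans (seq_osc_ge0 _ _ _ _) (oscM 1%N 1%N isT isT).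
have norm_le : (bmo_norm a <= (11 / 2 * M)%:E)%E.
  apply: ge_ereal_sup => _ [m [n [m1 mn ->]]]; rewrite lee_fin.
  exact: seq_osc_le_cesaro.
apply: le_trans (lee_wpmul2l _ norm_le) _.
  by rewrite lee_fin; lra.
by rewrite -EFinM lee_fin; nra.
Qed.
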